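(* There are absolute constants $c,T_0>0$ such that for every $T\ge T_0$ the following holds. For every randomized player algorithm in the stateful policies model there exist a set $\Pi$ of $k=3$ reactive policies over $n=3$ actions (hence stateful policies with $S=3$ states) and an oblivious sequence of reward functions $r_1,\dots,r_T:\{1,2,3\}\to[0,1]$ for which the expected regret of the algorithm with respect to $\Pi$ is at least $c\,T/\log^{3/2}T$. Moreover, this holds for the reference set $\Pi$ of the commute example: for $\Pi$ equal to that set and for every randomized player algorithm (which may depend on $\Pi$ and $T$), there is an oblivious sequence of reward functions $r_1,\dots,r_T:\{1,2,3\}\to[0,1]$ for which the expected regret with respect to $\Pi$ is at least $c\,T/\log^{3/2}T$.
   Context: Stateful policies model. There are $T$ rounds and a set $[n]=\{1,\dots,n\}$ of actions. Before the game begins, an oblivious adversary fixes reward functions $r_1,\dots,r_T:[n]\to[0,1]$. On each round $t$ the player chooses, possibly at random and based on everything observed so far, an action $X_t\in[n]$, receives the reward $r_t(X_t)$, and observes only this reward (bandit feedback). The player is given the full description of a finite reference set $\Pi$ of policies. For a policy $\pi$, $x_t^\pi$ denotes the action played by $\pi$ on round $t$ had it been followed from the beginning of the game. The expected regret with respect to $\Pi$ is $$\mathrm{Regret}_T=\max_{\pi\in\Pi}\sum_{t=1}^T r_t(x_t^\pi)-\mathbf E\Big[\sum_{t=1}^T r_t(X_t)\Big].$$ Reactive policy: a reactive policy $\pi$ over $n$ actions is specified by an initial action $x_1^\pi\in[n]$ and a function $\pi:[0,1]\to[n]$; when followed from the beginning it plays $x_1^\pi$ on round 1 and $x_{t+1}^\pi=\pi(r_t(x_t^\pi))$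 for $t\ge1$. (It is a finite state machine with $S=n$ states, where in state $i$ action $i$ is played, and the next state depends only on the last observed reward.) Commute example: $n=3$ and $\Pi$ consists of the three reactive policies with initial actions $1$, $2$, $3$ respectively, all sharing the same function $g:[0,1]\to\{1,2,3\}$ given by $g(x)=1$ if $|x-\tfrac12|\le\tfrac16$, $g(x)=2$ if $|x-\tfrac12|>\tfrac13$, and $g(x)=3$ otherwise. *)

(* Defs.v *)
From HB Require Import structures.
From mathcomp Require Import all_boot all_order all_algebra.
From mathcomp Require Import all_classical all_reals all_analysis.
Set Implicit Arguments.
Unset Strict Implicit.
Unset Printing Implicit Defensive.
Import Order.TTheory GRing.Theory Num.Theory.
Local Open Scope ring_scope.

(** Indices start at 0: round t+1 and action a+1 of the usual numbering are
    index t : nat and a : 'I_n.  Rewards have type {i01 R}, the reals of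
    [0, 1].  A reward sequence is indexed by all of nat, but in a game of T
    rounds only its values at t < T are ever used. *)
Definition rewards (R : realType) (n : nat) := nat -> 'I_n -> {i01 R}.

(** Bandit feedback: the observations made before a round are the past actions
    and the rewards of these actions, oldest first. *)
Definition observations (R : realType) (n : nat) := seq ('I_n * {i01 R}).

(** A randomized algorithm, as a behavioural strategy: [play h a] is the
    conditional probability of choosing a on the next round given that h was
    observed so far.  The current round is [size h]. *)
Record player (R : realType) (n : nat) := Player {
  play :> observations R n -> 'I_n -> R;
  play_ge0 : forall h a, 0 <= play h a;
  play_sum1 : forall h, \sum_(a < n) play h a = 1
}.

Section Play.
Variables (R : realType) (n T : nat).
Implicit Types (A : player R n) (r : rewards R n) (x : {ffun 'I_T -> 'I_n}).

Definition history r x (t : 'I_T) : observations R n :=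
  [seq (x s, r s (x s)) | s : 'I_T <- enum 'I_T & (s < t)%N].

(** The law of the sequence (X_1, ..., X_T) of actions of the player.  As r is
    fixed before the game, it is a distribution on a finite set. *)
Definition play_law A r x : R := \prod_(t < T) A (history r x t) (x t).

Definition expected_reward A r : R :=
  \sum_(x : {ffun 'I_T -> 'I_n}) play_law A r x * \sum_(t < T) (r t (x t))%:num.

End Play.

(** A stateful policy with S states: a finite state machine that plays
    [action s] when in state s and then moves according to the reward that it
    received. *)
Record stateful_policy (R : realType) (n S : nat) := StatefulPolicy {
  init_state : 'I_S;
  action : 'I_S -> 'I_n;
  next_state : 'I_S -> {i01 R} -> 'I_S
}.

Section Policies.
Variables (R : realType) (n S : nat).
Implicit Types (p : stateful_policy R n S) (r : rewards R n).

Fixpoint policy_state p r (t : nat) : 'I_S :=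
  if t is t'.+1 then
    let s := policy_state p r t' in next_state p s (r t' (action p s))
  else init_state p.

Definition policy_action p r t : 'I_n := action p (policy_state p r t).

Definition policy_reward (T : nat) p r : R :=
  \sum_(t < T) (r t (policy_action p r t))%:num.

End Policies.

(** The reference set is given as a nonempty finite family; the default value
    of the big maximum is one of its members, so this is the maximum. *)
Definition regret (R : realType) (n S k T : nat)
    (Pi : 'I_k.+1 -> stateful_policy R n S) (A : player R n) (r : rewards R n)
    : R :=
  \big[Num.max/policy_reward T (Pi ord0) r]_(i < k.+1) policy_reward T (Pi i) r
  - expected_reward T A r.

Record reactive_policy (R : realType) (n : nat) := ReactivePolicy {
  init_action : 'I_n;
  react : {i01 R} -> 'I_n
}.

Definition stateful_of_reactive (R : realType) (n : nat)
    (p : reactive_policy R n) : stateful_policy R n n :=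
  StatefulPolicy (init_action p) id (fun _ y => react p y).

Lemma reactive_action0 (R : realType) (n : nat) (p : reactive_policy R n)
    (r : rewards R n) :
  policy_action (stateful_of_reactive p) r 0 = init_action p.
Proof. by []. Qed.

Lemma reactive_actionS (R : realType) (n : nat) (p : reactive_policy R n)
    (r : rewards R n) (t : nat) :
  policy_action (stateful_of_reactive p) r t.+1
  = react p (r t (policy_action (stateful_of_reactive p) r t)).
Proof. by []. Qed.

Definition commute_map (R : realType) (y : {i01 R}) : 'I_3 :=
  let d := `|y%:num - 1 / 2| in
  if d <= 1 / 6 then @Ordinal 3 0 isT
  else if 1 / 3 < d then @Ordinal 3 1 isT
  else @Ordinal 3 2 isT.

Definition commute_policies (R : realType) (i : 'I_3) : reactive_policy R 3 :=
  ReactivePolicy i (@commute_map R).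

(* Main.v *)
(** A hidden good track g is carried along the rounds by independent uniform
    permutations of the three actions, which the rewards encode through
    [commute_map]: following a policy means staying on one of the three tracks,
    while leaving a track leads to one of the other two at random.  At round t
    the good track earns a bonus of one unit of order 1 / log^(3/2) T on top of
    a common level, the level being the sum of the noises attached to the
    O(log T) dyadic intervals that contain t.

    Suppose that the player is on the good track at round t and jumped for the
    last time at round tau.  Exchanging the two tracks that the player could
    have reached at tau, and adding one unit to the noise of the O(log T)
    maximal dyadic intervals contained in [tau, oo), changes none of the
    observations made before round t + 1, and takes the player off the good
    track.  The noise has two-sided geometric tails of scale O(log T), so the
    change of variables costs at most a factor 2 in probability: whatever its
    strategy, the player is off the good track with probability at least 1/3.

    Rewards are bounded because only a periodic tent function of the level is
    paid.  It rises on half of its period, and the period can be of order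
    log^(3/2) T, the standard deviation of a sum of O(log T) noises. *)

Require Import Defs.
From HB Require Import structures.
From mathcomp Require Import all_boot all_order all_algebra perm.
From mathcomp Require Import all_classical all_reals all_analysis.
From mathcomp Require Import zify ring lra.
Set Implicit Arguments.
Unset Strict Implicit.
Unset Printing Implicit Defensive.
Import Order.TTheory GRing.Theory Num.Theory.
Local Open Scope ring_scope.

(** * Law of the player's actions on prefixes of the game *)

Section PlayLaw.
Variables (R : realType) (n : nat).
Implicit Types (A : player R n) (r : rewards R n).

Definition extend (T : nat) (y : {ffun 'I_T -> 'I_n}) (a : 'I_n) :
    {ffun 'I_T.+1 -> 'I_n} :=
  [ffun i => if unlift ord_max i is Some j then y j else a].

Lemma extend_widen T (y : {ffun 'I_T -> 'I_n}) a (i : 'I_T) :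
  extend y a (widen_ord (leqnSn T) i) = y i.
Proof.
rewrite ffunE (_ : widen_ord _ i = lift ord_max i) ?liftK//.
by apply: val_inj; rewrite /= /bump leqNgt ltn_ord.
Qed.

Lemma extend_max T (y : {ffun 'I_T -> 'I_n}) a : extend y a ord_max = a.
Proof. by rewrite ffunE unlift_none. Qed.

Lemma sum_extend T (F : {ffun 'I_T.+1 -> 'I_n} -> R) :
  \sum_x F x = \sum_(y : {ffun 'I_T -> 'I_n}) \sum_a F (extend y a).
Proof.
rewrite pair_bigA/=.
rewrite (reindex (fun p : {ffun 'I_T -> 'I_n} * 'I_n => extend p.1 p.2))//.
exists (fun x : {ffun 'I_T.+1 -> 'I_n} =>
  ([ffun i => x (widen_ord (leqnSn T) i)], x ord_max)) => [[y a]|x] _ /=.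
  congr pair; last by rewrite extend_max.
  by apply/ffunP => i; rewrite ffunE extend_widen.
apply/ffunP => i; rewrite ffunE; case: unliftP => [j ->|-> //].
by rewrite ffunE; congr (x _); apply: val_inj; rewrite /= /bump leqNgt ltn_ord.
Qed.

Lemma history_extend T r (y : {ffun 'I_T -> 'I_n}) a (t : 'I_T) :
  history r (extend y a) (widen_ord (leqnSn T) t) = history r y t.
Proof.
rewrite /history enum_ordSr filter_rcons/= ltnNge ltnW//=.
rewrite filter_map -map_comp; apply: eq_map => s /=.
by rewrite extend_widen.
Qed.

Lemma history_ext T r r' (x : {ffun 'I_T -> 'I_n}) (t : 'I_T) :
  (forall s : 'I_T, (s < t)%N -> r s (x s) = r' s (x s)) ->
  history r x t = history r' x t.
Proof.
move=> rr'; apply/eq_in_map => s; rewrite mem_filter => /andP[st _].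
by rewrite rr'.
Qed.

(** An action is chosen before its own reward is seen, so the rewards of the last round may differ
    freely. The changes of variables below rely on this. *)
Lemma play_law_ext T A r r' (x : {ffun 'I_T -> 'I_n}) :
  (forall s : 'I_T, (s.+1 < T)%N -> r s (x s) = r' s (x s)) ->
  play_law A r x = play_law A r' x.
Proof.
move=> rr'; apply: eq_bigr => t _; congr (play A _ _).
by apply: history_ext => s st; apply: rr'; apply: leq_trans (ltn_ord t).
Qed.

Lemma play_law_ge0 T A r (x : {ffun 'I_T -> 'I_n}) : 0 <= play_law A r x.
Proof. by apply: prodr_ge0 => t _; apply: play_ge0. Qed.

Lemma play_law_extend T A r (y : {ffun 'I_T -> 'I_n}) a :
  play_law A r (extend y a) =
  play_law A r y * A (history r (extend y a) ord_max) a.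
Proof.
rewrite /play_law big_ord_recr/= extend_max; congr (_ * _).
by apply: eq_bigr => t _; rewrite history_extend extend_widen.
Qed.

Lemma history_extend_max T r (y : {ffun 'I_T -> 'I_n}) a b :
  history r (extend y a) ord_max = history r (extend y b) ord_max.
Proof.
rewrite /history enum_ordSr filter_rcons/= ltnn.
rewrite filter_map -!map_comp; apply: eq_map => s /=.
by rewrite !extend_widen.
Qed.

Lemma sum_play_law_extend T A r (y : {ffun 'I_T -> 'I_n}) :
  \sum_a play_law A r (extend y a) = play_law A r y.
Proof.
have [a0 _|no_action] := pickP (fun _ : 'I_n => true); last first.
  have := play_sum1 A [::]; rewrite big_pred0// => /eqP.
  by rewrite eq_sym oner_eq0.
under eq_bigr => a _ do rewrite play_law_extend (history_extend_max r y a a0).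
by rewrite -big_distrr/= play_sum1 mulr1.
Qed.

Lemma sum_play_law T A r : \sum_(x : {ffun 'I_T -> 'I_n}) play_law A r x = 1.
Proof.
elim: T => [|T IH].
  under eq_bigr => x _ do rewrite /play_law big_ord0.
  by rewrite sumr_const card_ffun !card_ord expn0.
rewrite sum_extend -[RHS]IH; apply: eq_bigr => y _.
exact: sum_play_law_extend.
Qed.

(** Summing out the actions after round [t] lets each round be studied on its own prefix. *)
Lemma expected_rewardE T A r :
  expected_reward T A r =
  \sum_(t < T) \sum_(x : {ffun 'I_t.+1 -> 'I_n})
    play_law A r x * (r t (x ord_max))%:num.
Proof.
elim: T => [|T IH].
  by rewrite big_ord0 /expected_reward big1// => x _; rewrite big_ord0 mulr0.
rewrite big_ord_recr/= -IH /expected_reward sum_extend [in RHS]sum_extend.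
rewrite -big_split/=.
apply: eq_bigr => y _.
rewrite -(sum_play_law_extend A r y) big_distrl/= -big_split/=.
apply: eq_bigr => a _; rewrite big_ord_recr/= mulrDr; congr (_ * _ + _).
by apply: eq_bigr => t _; rewrite extend_widen.
Qed.

End PlayLaw.

(** * Moments under unnormalised product weights *)

Section ProductWeights.
Variables (R : realFieldType) (I J : finType) (w : J -> R).
Hypothesis w_ge0 : forall j, 0 <= w j.

Definition weight (f : {ffun I -> J}) : R := \prod_i w (f i).

Lemma weight_ge0 f : 0 <= weight f.
Proof. by apply: prodr_ge0. Qed.

Lemma sum_weight_prod (g : I -> J -> R) :
  \sum_f weight f * \prod_i g i (f i) = \prod_i \sum_j w j * g i j.
Proof.
by rewrite bigA_distr_bigA; apply: eq_bigr => f _; rewrite -big_split.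
Qed.

(** Every other coordinate contributes the nonnegative factor [\sum_j w j]. *)
Lemma sum_weight1 (a : I) (h : J -> R) : 0 <= \sum_j w j * h j ->
  0 <= \sum_f weight f * h (f a).
Proof.
move=> h_ge0.
have -> : \sum_f weight f * h (f a) =
    \sum_f weight f * \prod_i (if i == a then h (f i) else 1).
  apply: eq_bigr => f _; rewrite (bigD1 a)//= eqxx big1 ?mulr1// => i /negbTE.
  by move=> ->.
rewrite (sum_weight_prod (fun i j => if i == a then h j else 1)).
apply: prodr_ge0 => i _; case: eqP => // _.
by apply: sumr_ge0 => j _; rewrite mulr1.
Qed.

Lemma sum_weight2 (a b : I) (d : J -> R) : a != b -> \sum_j w j * d j = 0 ->
  \sum_f weight f * (d (f a) * d (f b)) = 0.
Proof.
move=> ab d0.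
have -> : \sum_f weight f * (d (f a) * d (f b)) =
    \sum_f weight f * \prod_i (if (i == a) || (i == b) then d (f i) else 1).
  apply: eq_bigr => f _; rewrite (bigD1 a)//= eqxx (bigD1 b) 1?eq_sym//=.
  rewrite eqxx orbT big1 ?mulr1// => i /andP[/negbTE-> /negbTE->] //.
rewrite (sum_weight_prod (fun i j => if (i == a) || (i == b) then d j else 1)).
by rewrite (bigD1 a)//= eqxx/= d0 mul0r.
Qed.

(** Cross terms vanish because [d] is centred. The last hypothesis bounds the second moment by [c]
    without normalising [w]. *)
Lemma sum_weight_sqr (L : nat) (node : 'I_L -> I) (d : J -> R) (c : R) :
  injective node -> \sum_j w j * d j = 0 ->
  0 <= \sum_j w j * (c - d j ^+ 2) ->
  \sum_f weight f * (\sum_l d (f (node l))) ^+ 2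
    <= L%:R * c * \sum_f weight f.
Proof.
move=> node_inj d0 dc.
have -> : \sum_f weight f * (\sum_l d (f (node l))) ^+ 2 =
    \sum_l \sum_f weight f * d (f (node l)) ^+ 2.
  under eq_bigr => f _ do rewrite expr2 big_distrlr/= big_distrr/=.
  rewrite exchange_big/=; apply: eq_bigr => l _.
  under eq_bigr => f _ do rewrite big_distrr/=.
  rewrite exchange_big/= (bigD1 l)//= [X in _ + X]big1 ?addr0//.
  by move=> m ml; rewrite sum_weight2// inj_eq// eq_sym.
rewrite -mulrA mulr_natl -[L in X in _ <= X]card_ord -sumr_const.
apply: ler_sum => l _; rewrite -subr_ge0 big_distrr/= -sumrB.
under eq_bigr => f _ do rewrite [c * _]mulrC -mulrBr.
exact: (@sum_weight1 (node l) (fun j => c - d j ^+ 2)).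
Qed.

End ProductWeights.

(** * Two-sided geometric noise on a cycle *)

Section Noise.
Variables (R : realFieldType) (h : nat).

(** Both middle values [h - 1] and [h] are at distance 0, which makes the weights symmetric under
    [rev_ord]. *)
Definition center_dist (k : nat) : nat :=
  if (k < h)%N then (h.-1 - k)%N else (k - h)%N.

Definition noise_weight (q : R) (k : 'I_(h + h)) : R := q ^+ center_dist k.

(** Twice the signed distance to the midpoint [h - 1/2]. *)
Definition deviation (k : 'I_(h + h)) : R := (2 * k + 1)%:R - (2 * h)%:R.

Lemma noise_weight_ge0 q : 0 <= q -> forall k, 0 <= noise_weight q k.
Proof. by move=> q0 k; rewrite exprn_ge0. Qed.

(** The wrap-around from [h + h - 1] to 0 is free: both ends have [center_dist] equal to [h - 1]. *)
Lemma noise_weight_ordS q : 0 <= q <= 1 -> forall k,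
  q * noise_weight q k <= noise_weight q (ordS k).
Proof.
move=> /andP[q0 q1] k; rewrite /noise_weight -exprS ler_wiXn2l//.
case: k => k /= kh; rewrite /center_dist.
have [kN|kN] := eqVneq k.+1 (h + h)%N; first by
  rewrite kN modnn; do 2 case: ifP => ?; lia.
by rewrite modn_small; [do 2 case: ifP => ?; lia|lia].
Qed.

Lemma noise_weight_rev q k : noise_weight q (rev_ord k) = noise_weight q k.
Proof.
case: k => k kh; congr (_ ^+ _); rewrite /center_dist /=.
by do 2 case: ifP => ?; lia.
Qed.

Lemma deviation_rev k : deviation (rev_ord k) = - deviation k.
Proof.
case: k => k kh; rewrite /deviation /= opprB.
apply/eqP; rewrite subr_eq addrAC eq_sym subr_eq -!natrD eq_sym.
by apply/eqP; congr (_%:R); lia.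
Qed.

Lemma sum_deviation q : \sum_k noise_weight q k * deviation k = 0.
Proof.
have : \sum_k noise_weight q k * deviation k
    = - \sum_k noise_weight q k * deviation k.
  rewrite {1}(reindex_inj rev_ord_inj)/= -sumrN; apply: eq_bigr => k _.
  by rewrite noise_weight_rev deviation_rev mulrN.
lra.
Qed.

(** The left-hand side makes the induction on n work; only its sign matters. *)
Lemma sum_geometric_sqr (K : R) n : 1 <= K ->
  (4 * K * n%:R ^+ 2 + 8 * K ^+ 2 * n%:R) * (1 - K^-1) ^+ n
  <= \sum_(i < n) (1 - K^-1) ^+ i * (13 * K ^+ 2 - (2 * i + 1)%:R ^+ 2).
Proof.
move=> K1; have q0 : 0 <= 1 - K^-1 by rewrite subr_ge0 invf_le1//; lra.
elim: n => [|n IH]; first by rewrite big_ord0 !(mulr0, expr0n, addr0, mul0r).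
rewrite big_ord_recr/=; apply: le_trans (lerD IH (lexx _)).
have -> : (n.+1%:R : R) = n%:R + 1 by rewrite -natr1.
rewrite [_ ^+ n.+1]exprSr natrD natrM mulr1n -subr_ge0.
set z := (1 - K^-1) ^+ n.
have -> : (4 * K * n%:R ^+ 2 + 8 * K ^+ 2 * n%:R) * z +
    z * (13 * K ^+ 2 - (2 * n%:R + 1) ^+ 2) -
    (4 * K * (n%:R + 1) ^+ 2 + 8 * K ^+ 2 * (n%:R + 1)) * (z * (1 - K^-1)) =
    z * (5 * K ^+ 2 + 4 * K + 3 + 4 * n%:R) by field; lra.
have n_ge0 : 0 <= (n%:R : R) by [].
by rewrite mulr_ge0 ?exprn_ge0//; nra.
Qed.

(** Folded at the centre, each half is the sum of [sum_geometric_sqr]. *)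
Lemma sum_deviation_sqr (K : R) : 1 <= K ->
  0 <= \sum_k noise_weight (1 - K^-1) k * (13 * K ^+ 2 - deviation k ^+ 2).
Proof.
move=> K1; rewrite big_split_ord/= [X in X + _](reindex_inj rev_ord_inj)/=.
have q0 : 0 <= 1 - K^-1 by rewrite subr_ge0 invf_le1//; lra.
have geom := sum_geometric_sqr h K1.
have : 0 <= (4 * K * h%:R ^+ 2 + 8 * K ^+ 2 * h%:R) * (1 - K^-1) ^+ h.
  rewrite mulr_ge0 ?exprn_ge0// addr_ge0 ?mulr_ge0 ?exprn_ge0//; lra.
move=> /le_trans/(_ geom) geom0.
rewrite addr_ge0//; apply: (le_trans geom0); apply: ler_sum => -[i ih] _;
    rewrite /noise_weight /deviation /center_dist /=.
- have -> : (h - i.+1 < h)%N by lia.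
  have -> : (h.-1 - (h - i.+1) = i)%N by lia.
  rewrite (_ : (2 * (h - i.+1) + 1)%:R - (2 * h)%:R = - (2 * i + 1)%:R :> R).
    by rewrite sqrrN.
  apply/eqP; rewrite subr_eq addrC eq_sym subr_eq -natrD.
  by apply/eqP; congr (_%:R); lia.
- have -> : (h + i < h)%N = false by lia.
  have -> : (h + i - h = i)%N by lia.
  rewrite (_ : (2 * (h + i) + 1)%:R - (2 * h)%:R = (2 * i + 1)%:R :> R) ?lexx//.
  by apply/eqP; rewrite subr_eq -natrD; apply/eqP; congr (_%:R); lia.
Qed.

End Noise.

(** * Dyadic noise and its shifts on suffixes *)

Notation tree_noise L T N := {ffun 'I_L * 'I_T.+1 -> 'I_N}.

Section DyadicNoise.
Variables (L T N : nat).
Implicit Types xi : tree_noise L T N.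

Definition noise xi (t : nat) : nat :=
  (\sum_(j < L) xi (j, inord (t %/ 2 ^ j)%N))%N.

(** The maximal dyadic intervals [m 2^j, (m+1) 2^j) contained in [tau, oo). *)
Definition in_suffix (tau j m : nat) : bool :=
  (m %/ 2 * 2 ^ j.+1 < tau <= m * 2 ^ j)%N.

(** The dyadic intervals around [t] grow with the scale; the largest one inside [[tau, oo)] is
    counted at its own scale, or by the remaining term if scale [n] still fits. *)
Lemma sum_in_suffix tau t n :
  (\sum_(j < n) in_suffix tau j (t %/ 2 ^ j) + (tau <= t %/ 2 ^ n * 2 ^ n)
   = (tau <= t))%N.
Proof.
elim: n => [|n IH]; first by rewrite big_ord0 expn0 divn1 muln1.
rewrite big_ord_recr/= -addnA -IH; congr addn.
rewrite /in_suffix -divnMA -expnSr.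
have : (t %/ 2 ^ n.+1 * 2 ^ n.+1 <= t %/ 2 ^ n * 2 ^ n)%N.
  by rewrite expnSr divnMA mulnCA [leqRHS]mulnC leq_mul2l leq_divM orbT.
case: ltnP => /=; case: leqP => /=; lia.
Qed.

Lemma in_suffix_uniq tau j m m' :
  in_suffix tau j m -> in_suffix tau j m' -> m = m'.
Proof.
have le_suffix a b : in_suffix tau j a -> in_suffix tau j b -> (a <= b)%N.
  move=> /andP[lt_a _] /andP[_ le_b].
  have := leq_trans lt_a le_b.
  rewrite expnSr mulnCA mulnC ltn_pmul2r ?expn_gt0// => lt_ab.
  have := divn_eq a 2; have := ltn_pmod a (isT : (0 < 2)%N); lia.
by move=> sm sm'; apply/eqP; rewrite eqn_leq !le_suffix.
Qed.

Definition shift_suffix tau xi : tree_noise L T N :=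
  [ffun nd : 'I_L * 'I_T.+1 =>
    if in_suffix tau nd.1 nd.2 then ordS (xi nd) else xi nd].

Lemma shift_suffix_inj tau : injective (shift_suffix tau).
Proof.
move=> xi xi' /ffunP e; apply/ffunP => nd; have := e nd.
by rewrite !ffunE; case: ifP => // _; apply: ordS_inj.
Qed.

Lemma noise_shift tau xi t : (0 < tau)%N -> (t < 2 ^ L)%N -> (t <= T)%N ->
  noise (shift_suffix tau xi) t = noise xi t + (tau <= t) %[mod N].
Proof.
move=> tau0 tL tT.
have := sum_in_suffix tau t L.
(* As [t < 2 ^ L] and [tau > 0], the remaining term vanishes. *)
rewrite divn_small// mul0n leqNgt tau0/= addn0 => <-.
rewrite /noise -big_split/=.
apply: (big_ind2 (fun a b => a = b %[mod N])) => // [a b c d ab cd|j _].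
  by rewrite -modnDm ab cd modnDm.
rewrite ffunE/= inordK ?ltnS ?(leq_trans (leq_div _ _))//.
by case: in_suffix; rewrite /= ?addn1 ?addn0// modn_mod.
Qed.

End DyadicNoise.

Section DyadicNoiseWeight.
Variables (R : realFieldType) (L T h : nat) (q : R).
Hypothesis q01 : 0 <= q <= 1.

(** At most one interval per scale is shifted, and each shift costs at most a factor [q]. *)
Lemma weight_shift tau (xi : tree_noise L T (h + h)) :
  q ^+ L * weight (noise_weight q) xi
    <= weight (noise_weight q) (shift_suffix tau xi).
Proof.
have [q0 q1] := andP q01.
set in_D := fun nd : 'I_L * 'I_T.+1 => in_suffix tau nd.1 nd.2 : nat.
have sum_D : (\sum_nd in_D nd <= L)%N.
  rewrite -(pair_bigA _ (fun (j : 'I_L) (m : 'I_T.+1) =>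
    in_suffix tau j m : nat))/=.
  rewrite -[leqRHS]card_ord -sum1_card; apply: leq_sum => j _.
  rewrite -big_mkcond/= sum1_card; apply/card_le1_eqP => m m'.
  by move=> sm sm'; apply: val_inj; apply: (@in_suffix_uniq tau j).
apply: (@le_trans _ _ (\prod_nd q ^+ in_D nd * weight (noise_weight q) xi)).
  rewrite ler_wpM2r ?weight_ge0//; first exact: noise_weight_ge0.
  by rewrite prodrXr ler_wiXn2l.
rewrite -big_split/=; apply: ler_prod => nd _; rewrite ffunE /in_D.
rewrite mulr_ge0 ?exprn_ge0 ?noise_weight_ge0//=.
case: in_suffix; last by rewrite mul1r.
by rewrite expr1 noise_weight_ordS.
Qed.

End DyadicNoiseWeight.

(** * The periodic tent function *)

Section Tent.
Variable h : nat.

Definition tent (v : nat) : nat := minn (v %% (h + h)) (h + h - v %% (h + h)).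

Lemma tent_mod v w : v = w %[mod h + h] -> tent v = tent w.
Proof. by rewrite /tent => ->. Qed.

Lemma tent_le v : (tent v <= h)%N.
Proof. by rewrite /tent; lia. Qed.

Lemma tent_step v : (0 < h)%N ->
  tent v.+1 + (h <= v %% (h + h))%N = tent v + (v %% (h + h) < h)%N.
Proof.
move=> h0; rewrite /tent -addn1 -modnDml.
have : (v %% (h + h) < h + h)%N by rewrite ltn_pmod ?addn_gt0 ?h0.
move: (v %% (h + h))%N => m mh.
have [m1|m1] := eqVneq (m + 1)%N (h + h)%N; first by rewrite m1 modnn; lia.
by rewrite modn_small; lia.
Qed.

End Tent.

(** * Concentration of the level on the rising half of the tent *)

Section Concentration.
Variables (R : realFieldType) (l M T : nat).
Let h := M.*2.
Let L := l.*2.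
Implicit Types xi : tree_noise L T (h + h).

(** The offset l + M places the typical values of the level in the middle of
    the interval [0, h) on which the tent rises. *)
Definition level xi (t : nat) : nat :=
  (l + M + noise xi t)%N.

Lemma level_shift tau xi t : (0 < tau)%N -> (t < 2 ^ L)%N -> (t <= T)%N ->
  level (shift_suffix tau xi) t = level xi t + (tau <= t) %[mod h + h].
Proof.
by move=> *; rewrite /level -modnDmr noise_shift// modnDmr addnA.
Qed.

Definition rising xi t : bool := (level xi t %% (h + h) < h)%N.

(** The sum is twice the distance from the noise to [L (h - 1/2)]. Below [h], it keeps the level
    within [h / 2] of [l (h + h) + M], where [M = h / 2]. *)
Lemma rising_deviation xi t :
  `|\sum_(j < L) deviation R (xi (j, inord (t %/ 2 ^ j)%N))| < h%:R ->
  rising xi t.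
Proof.
have -> : \sum_(j < L) deviation R (xi (j, inord (t %/ 2 ^ j)%N)) =
    (2 * noise xi t + L)%:R - (2 * h * L)%:R.
  rewrite /deviation sumrB sumr_const card_ord -mulrnA.
  rewrite -natr_sum big_split/= -big_distrr/=.
  by rewrite sum1_card card_ord.
rewrite ltr_norml ltrBrDr [- _ + _]addrC !ltrBlDr.
rewrite -!natrD !ltr_nat /rising /level => /andP[lo hi].
have [r e rM] : exists2 r, (l + M + noise xi t = l * (h + h) + r)%N & (r < h)%N.
  exists (l + M + noise xi t - l * (h + h))%N;
    by move: lo hi; rewrite /h /L; nia.
by rewrite e modnMDl modn_small//; lia.
Qed.

(** Chebyshev's inequality for the sum of [L] centred deviations. *)
Lemma not_rising_rare (K : R) t : 1 <= K -> (0 < M)%N ->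
  12 * (L%:R * (13 * K ^+ 2)) <= h%:R ^+ 2 ->
  12 * \sum_(xi : tree_noise L T (h + h))
      weight (noise_weight (1 - K^-1)) xi * (~~ rising xi t)%:R
    <= \sum_(xi : tree_noise L T (h + h)) weight (noise_weight (1 - K^-1)) xi.
Proof.
move=> K1 M0 small.
have q0 : 0 <= 1 - K^-1 by rewrite subr_ge0 invf_le1//; lra.
have w0 := noise_weight_ge0 q0 : forall k : 'I_(h + h), _.
have h2 : 0 < (h%:R : R) ^+ 2 by rewrite exprn_gt0// ltr0n double_gt0.
pose node (j : 'I_L) : 'I_L * 'I_T.+1 := (j, inord (t %/ 2 ^ j)%N).
have node_inj : injective node by move=> i j [].
have := sum_weight_sqr w0 node_inj (sum_deviation h (1 - K^-1))
  (sum_deviation_sqr h K1).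
set S := \sum_f weight _ f.
move=> le_sqr.
have S0 : 0 <= S by apply: sumr_ge0 => f _; apply: weight_ge0.
have cheb : h%:R ^+ 2 * \sum_(xi : tree_noise L T (h + h))
      weight (noise_weight (1 - K^-1)) xi * (~~ rising xi t)%:R
    <= L%:R * (13 * K ^+ 2) * S.
  apply: le_trans le_sqr; rewrite big_distrr/=; apply: ler_sum => xi _.
  rewrite mulrCA ler_wpM2l ?weight_ge0//.
  case: (boolP (rising xi t)) => [_|bad]; first by rewrite mulr0 sqr_ge0.
  rewrite mulr1 -[leRHS]real_normK ?num_real// lerXn2r ?nnegrE//.
  by rewrite leNgt; apply: contra bad; apply: rising_deviation.
rewrite -(ler_pM2l h2) mulrCA; apply: le_trans (ler_wpM2l _ cheb) _ => //.
by rewrite [leLHS]mulrA ler_wpM2r.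
Qed.

End Concentration.

(** * Last index satisfying a predicate *)

Section LastTrue.
Implicit Types P Q : pred nat.

(** The default 0 is also returned when [P] fails everywhere up to [n]. *)
Fixpoint last_true P (n : nat) : nat :=
  if P n then n else if n is n'.+1 then last_true P n' else 0.

Lemma last_true_le P n : (last_true P n <= n)%N.
Proof. by elim: n => [|n IH] /=; case: ifP => // _; apply: leqW. Qed.

Lemma last_true_after P n k : (last_true P n < k <= n)%N -> ~~ P k.
Proof.
elim: n => [|n IH] /=; case: ifP => [_|Pn]; try by lia.
case/andP=> lt_k; rewrite leq_eqVlt => /orP[/eqP->|kn]; first by rewrite Pn.
by apply: IH; rewrite lt_k.
Qed.

Lemma last_trueP P n : P (last_true P n) || (last_true P n == 0%N).
Proof. by elim: n => [|n IH] /=; case: ifP => [->|] //; rewrite eqxx orbT. Qed.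

Lemma eq_last_true P Q n :
  (forall k, (k <= n)%N -> P k = Q k) -> last_true P n = last_true Q n.
Proof.
elim: n => [|n IH] PQ /=; first by rewrite PQ.
by rewrite PQ// IH// => k kn; apply: PQ; apply: leqW.
Qed.

End LastTrue.

(** * Hidden tracks and the exchange that leaves the good one *)

Definition swap_others (p : 'I_3) : {perm 'I_3} := tperm (p + 1) (p + 2).

Lemma swap_others_fix p : swap_others p p = p.
Proof. by rewrite tpermD//; case: p => -[|[|[|]]]. Qed.

Lemma swap_others_move p i : i != p -> swap_others p i != i.
Proof.
move=> ip; have : (i == p + 1) || (i == p + 2).
  by move: ip; case: p => -[|[|[|]]]//=; case: i => -[|[|[|]]].
by rewrite /swap_others; case/orP => /eqP->; rewrite ?tpermL ?tpermR;
  case: p {ip} => -[|[|[|]]].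
Qed.

Section Tracks.
Variable T : nat.
Implicit Types (s : {ffun 'I_T.+1 -> {perm 'I_3}}) (X : nat -> 'I_3).

Fixpoint good s (t : nat) : 'I_3 :=
  s (inord t) (if t is t'.+1 then good s t' else ord0).

Lemma goodS s t : good s t.+1 = s (inord t.+1) (good s t).
Proof. by []. Qed.

Lemma eq_good s s' t :
  (forall k, (k <= t)%N -> s (inord k) = s' (inord k)) -> good s t = good s' t.
Proof.
elim: t => [|t IH] ss' /=; first by rewrite ss'.
by rewrite ss'// IH// => k kt; apply: ss'; apply: leqW.
Qed.

(** A fictitious action before round 0, different from the origin [ord0] of
    the good track, makes every way to be on that track start with a jump. *)
Definition previous X (t : nat) : 'I_3 := if t is t'.+1 then X t' else 1.

Definition jump s X (t : nat) : bool := X t != s (inord t) (previous X t).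

Definition last_jump s X t := last_true (jump s X) t.

(** Products of permutations act from left to right: the exchange comes before [s k], so it fixes
    the track that the player has just left. *)
Definition swap_tracks X t s : {ffun 'I_T.+1 -> {perm 'I_3}} :=
  [ffun k => if k == inord (last_jump s X t)
             then (swap_others (previous X (last_jump s X t)) * s k)%g
             else s k].

Lemma inord_eq (i j : nat) : (i <= T)%N -> (j <= T)%N ->
  (inord i == inord j :> 'I_T.+1) = (i == j).
Proof. by move=> iT jT; rewrite -val_eqE/= !inordK. Qed.

Lemma swap_tracks_previous X t s k : (t <= T)%N -> (k <= T)%N ->
  swap_tracks X t s (inord k) (previous X k) = s (inord k) (previous X k).
Proof.
move=> tT kT; have le_t := last_true_le (jump s X) t.
rewrite ffunE inord_eq ?(leq_trans le_t)//; case: eqP => // ->.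
by rewrite permM swap_others_fix.
Qed.

(** A jump depends only on the image of the previous action, which the exchange preserves. The jump
    time can thus be recovered, whence injectivity. *)
Lemma last_jump_swap X t s : (t <= T)%N ->
  last_jump (swap_tracks X t s) X t = last_jump s X t.
Proof.
move=> tT; apply: eq_last_true => k kt.
by rewrite /jump swap_tracks_previous// (leq_trans kt).
Qed.

Lemma swap_tracks_inj X t : (t <= T)%N -> injective (swap_tracks X t).
Proof.
move=> tT s s' e.
have ej : last_jump s X t = last_jump s' X t.
  by rewrite -(last_jump_swap X s)// e last_jump_swap.
apply/ffunP => k; have /ffunP/(_ k) := e; rewrite !ffunE ej.
by case: ifP => // _; apply: mulgI.
Qed.

Section OnGoodTrack.
Variables (X : nat -> 'I_3) (t : nat) (s : {ffun 'I_T.+1 -> {perm 'I_3}}).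
Hypotheses (tT : (t <= T)%N) (Xt : X t = good s t).
Let tau := last_jump s X t.
Let s' := swap_tracks X t s.

Lemma on_good_since k : (tau <= k <= t)%N -> X k = good s k.
Proof.
move=> /andP[tau_k kt].
have [n tE] : exists n, t = (k + n)%N by exists (t - k)%N; lia.
have : forall m, (m <= n)%N -> X (k + (n - m))%N = good s (k + (n - m)).
  elim=> [|m IH] mn; first by rewrite subn0 -tE.
  have := IH (ltnW mn); have -> : (k + (n - m) = (k + (n - m.+1)).+1)%N by lia.
  have : ~~ jump s X (k + (n - m.+1)).+1.
    by apply: (@last_true_after _ t); rewrite -/(last_jump s X t) -/tau; lia.
  by rewrite /jump negbK => /eqP -> /=; apply: perm_inj.
by move=> /(_ n (leqnn n)); rewrite subnn addn0.
Qed.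

Lemma good_swap_before k : (k < tau)%N -> good s' k = good s k.
Proof.
move=> k_tau; apply: eq_good => j jk.
have le_t : (tau <= t)%N := last_true_le (jump s X) t.
rewrite ffunE inord_eq ?(leq_trans le_t)// -/tau; last by lia.
by case: eqP => // jt; lia.
Qed.

(** The good track does not come from [previous X tau], so the exchange moves it; injectivity of the
    later permutations keeps the two tracks apart. *)
Lemma good_swap_after k : (tau <= k <= t)%N -> good s' k != good s k.
Proof.
have le_t : (tau <= t)%N := last_true_le (jump s X) t.
have Xtau : X tau = good s tau by apply: on_good_since; rewrite leqnn.
have at_tau : s' (inord tau) = (swap_others (previous X tau) * s (inord tau))%g.
  by rewrite ffunE eqxx.
elim: k => [|k IH] /andP[tau_k kt].
  have tau0 : tau = 0%N by lia.
  move: at_tau Xtau; rewrite tau0 /= => -> /= X0.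
  rewrite permM (inj_eq perm_inj).
  by apply: swap_others_move.
rewrite !goodS.
have [tauE|tau_neq] := eqVneq tau k.+1.
  rewrite -tauE at_tau permM (inj_eq perm_inj) good_swap_before ?tauE//.
  apply: swap_others_move => /=.
  have := last_trueP (jump s X) t; rewrite -/(last_jump s X t) -/tau tauE orbF.
  by rewrite /jump -tauE Xtau tauE goodS (inj_eq perm_inj).
rewrite ffunE inord_eq ?(leq_trans le_t)// -/tau ?(leq_trans kt)//.
rewrite [_ == tau]eq_sym (negbTE tau_neq) (inj_eq perm_inj) IH//; lia.
Qed.

End OnGoodTrack.
End Tracks.

(** * Bounded rewards that encode the next action *)

Section Rewards.
Variables (R : realType) (h : nat).

(** Points from which a window of length 1/8 stays inside the region that
    [commute_map] sends to the given action. *)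
Definition center (c : 'I_3) : R := nth 0 [:: 1 / 2; 0; 1 / 6] c.

Definition reward_value (c : 'I_3) (v : nat) : R :=
  center c + (tent h v)%:R / (8 * h)%:R.

Lemma tent_ratio v : 0 <= ((tent h v)%:R / (8 * h)%:R : R) <= 1 / 8.
Proof.
rewrite divr_ge0//=; have [->|h0] := posnP h.
  by rewrite muln0 invr0 mulr0; lra.
rewrite ler_pdivrMr ?ltr0n ?muln_gt0//.
have : (tent h v)%:R <= h%:R :> R by rewrite ler_nat tent_le.
rewrite natrM; lra.
Qed.

Lemma reward_value_ge0 c v : 0 <= reward_value c v.
Proof.
have /andP[lo hi] := tent_ratio v; rewrite /reward_value /center.
by case: c => -[|[|[|]]]//= _; lra.
Qed.

Lemma reward_value_le1 c v : reward_value c v <= 1.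
Proof.
have /andP[lo hi] := tent_ratio v; rewrite /reward_value /center.
by case: c => -[|[|[|]]]//= _; lra.
Qed.

Definition reward (c : 'I_3) (v : nat) : {i01 R} :=
  Itv01 (reward_value_ge0 c v) (reward_value_le1 c v).

Lemma commute_reward c v : commute_map (reward c v) = c.
Proof.
have /andP[lo hi] := tent_ratio v.
rewrite /commute_map /= /reward_value /center.
move: lo hi; set y := _ / _ => lo hi.
case: c => -[|[|[|]]]//= i.
- have -> : `|1 / 2 + y - 1 / 2| <= 1 / 6 by rewrite ger0_norm; lra.
  exact: val_inj.
- rewrite ler0_norm; last by lra.
  have -> : (- (0 + y - 1 / 2) <= 1 / 6) = false
    by apply/negbTE; rewrite -ltNge; lra.
  have -> : 1 / 3 < - (0 + y - 1 / 2) by lra.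
  exact: val_inj.
- rewrite ler0_norm; last by lra.
  have -> : (- (1 / 6 + y - 1 / 2) <= 1 / 6) = false
    by apply/negbTE; rewrite -ltNge; lra.
  have -> : (1 / 3 < - (1 / 6 + y - 1 / 2)) = false
    by apply/negbTE; rewrite -leNgt; lra.
  exact: val_inj.
Qed.

Lemma reward_mod c v w : v = w %[mod h + h] -> reward c v = reward c w.
Proof.
by move=> vw; apply: val_inj; rewrite /= /reward_value (tent_mod vw).
Qed.

End Rewards.

(** * The random adversary and the regret of one round *)

Section Adversary.
Variables (R : realType) (l M T : nat) (K : R) (A : player R 3).
Let h := M.*2.
Let L := l.*2.
Let q := 1 - K^-1.

Notation tracks := {ffun 'I_T.+1 -> {perm 'I_3}}.
Notation omega := (tracks * tree_noise L T (h + h))%type.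

(** Round t reads the noise at time t + 1, so that every suffix [tau, oo) of
    interest has tau > 0 and is a union of the dyadic intervals in use, which
    do not include the whole of [0, 2^L). *)
Definition adversary (w : omega) : rewards R 3 := fun t i =>
  reward R h (w.1 (inord t.+1) i) (level w.2 t.+1 + (i == good w.1 t)).

(** Unnormalised probability: the uniform permutations would only add a constant factor. *)
Definition mass (w : omega) : R := weight (noise_weight q) w.2.

Hypotheses (K1 : 1 <= K) (M0 : (0 < M)%N) (TL : (T < 2 ^ L)%N).
Hypothesis qL : 1 / 2 <= q ^+ L.
Hypothesis small : 12 * (L%:R * (13 * K ^+ 2)) <= h%:R ^+ 2.

Lemma q_itv : 0 <= q <= 1.
Proof.
have K0 : 0 < K := lt_le_trans ltr01 K1.
by rewrite /q subr_ge0 invf_le1// K1 lerBlDr lerDl invr_ge0 ltW.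
Qed.

Lemma mass_ge0 w : 0 <= mass w.
Proof. by apply/weight_ge0/noise_weight_ge0; have /andP[] := q_itv. Qed.

Section Round.
Variable t : nat.
Hypothesis tT : (t < T)%N.

Section Actions.
Variable x : {ffun 'I_t.+1 -> 'I_3}.
Let X (k : nat) : 'I_3 := x (inord k).

Definition joint (w : omega) : R := mass w * play_law A (adversary w) x.

Lemma joint_ge0 w : 0 <= joint w.
Proof. by rewrite mulr_ge0 ?mass_ge0 ?play_law_ge0. Qed.

Lemma XE (k : 'I_t.+1) : x k = X k.
Proof. by rewrite /X inord_val. Qed.

(** The successor reflects that rewards from round [tau] on read the noise from time [tau + 1]
    on. *)
Definition leave_good (w : omega) : omega :=
  (swap_tracks X t w.1, shift_suffix (last_jump w.1 X t).+1 w.2).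

Lemma leave_good_inj : injective leave_good.
Proof.
move=> [s xi] [s' xi'] [/(swap_tracks_inj (ltnW tT)) ss'].
by rewrite ss' => /shift_suffix_inj ->.
Qed.

(** From the last jump on, the raised level replaces the lost bonus; before it, neither changes. *)
Lemma play_law_leave_good w : X t = good w.1 t ->
  play_law A (adversary w) x = play_law A (adversary (leave_good w)) x.
Proof.
case: w => s xi /= Xt; apply: play_law_ext => k kt; rewrite XE /adversary /=.
have kT : (k.+1 <= T)%N by lia.
rewrite (swap_tracks_previous X s (ltnW tT) kT).
apply: reward_mod; rewrite -[in RHS]modnDml level_shift//; last first.
  exact: leq_ltn_trans kT TL.
rewrite modnDml ltnS.
have [k_tau|tau_k] := ltnP k (last_jump s X t).
  by rewrite good_swap_before ?(ltnW tT)// addn0.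
have tau_kt : (last_jump s X t <= k <= t)%N by rewrite tau_k/=; lia.
have /negbTE := good_swap_after (ltnW tT) Xt tau_kt.
by rewrite (on_good_since (ltnW tT) Xt tau_kt) eqxx eq_sym => ->; rewrite addn0.
Qed.

Lemma joint_leave_good w : X t = good w.1 t ->
  q ^+ L * joint w <= joint (leave_good w).
Proof.
move=> Xt; rewrite /joint -play_law_leave_good// mulrA.
by rewrite ler_wpM2r ?play_law_ge0// weight_shift// q_itv.
Qed.

(** [leave_good] maps the event of being on the good track injectively into its complement, at a
    cost [q ^+ L >= 1/2]. *)
Lemma sum_joint_good :
  \sum_w joint w <= 3 * \sum_w joint w * (X t != good w.1 t)%:R.
Proof.
have coupled : q ^+ L * \sum_w joint w * (X t == good w.1 t)%:R
    <= \sum_w joint w * (X t != good w.1 t)%:R.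
  rewrite [leRHS](reindex_inj leave_good_inj)/= big_distrr/=.
  apply: ler_sum => w _; case: eqP => [Xt|_]; last first.
    by rewrite !mulr0 mulr_ge0 ?joint_ge0.
  rewrite mulr1 Xt eq_sym good_swap_after ?mulr1 ?(ltnW tT)//.
    exact: joint_leave_good.
  by rewrite leqnn andbT last_true_le.
have good_ge0 : 0 <= \sum_w joint w * (X t == good w.1 t)%:R.
  by apply: sumr_ge0 => w _; rewrite mulr_ge0 ?joint_ge0.
have -> : \sum_w joint w = \sum_w joint w * (X t == good w.1 t)%:R +
    \sum_w joint w * (X t != good w.1 t)%:R.
  rewrite -big_split/=; apply: eq_bigr => w _.
  by rewrite -mulrDr; case: eqP; rewrite /= ?addr0 ?add0r mulr1.
have := ler_wpM2r good_ge0 qL; lra.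
Qed.

(** Exchanging the next positions of the good track and of the player shows
    that the centers contribute nothing to the expected regret. *)
Definition exchange_next (w : omega) : omega :=
  ([ffun k => if k == inord t.+1
              then (tperm (X t) (good w.1 t) * w.1 k)%g else w.1 k], w.2).

Lemma exchange_next_before w k : (k <= t)%N ->
  (exchange_next w).1 (inord k) = w.1 (inord k).
Proof.
move=> kt; rewrite ffunE inord_eq; [|lia|lia].
by case: eqP => // ?; lia.
Qed.

Lemma good_exchange_next w k : (k <= t)%N ->
  good (exchange_next w).1 k = good w.1 k.
Proof.
move=> kt; apply: eq_good => j jk.
by rewrite exchange_next_before// (leq_trans jk).
Qed.

Lemma exchange_nextK : involutive exchange_next.
Proof.
move=> w; rewrite {1}/exchange_next good_exchange_next//; case: w => s xi.
congr pair; apply/ffunP => k; rewrite !ffunE.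
by case: eqP => // _; rewrite mulgA tperm2 mul1g.
Qed.

(** The permutation at [t + 1] is first read by the reward of round [t], after the last action of
    [x] is chosen. *)
Lemma joint_exchange_next w : joint (exchange_next w) = joint w.
Proof.
congr (_ * _); apply: play_law_ext => k kt; rewrite /adversary.
by rewrite exchange_next_before// good_exchange_next//; lia.
Qed.

Lemma sum_joint_center :
  \sum_w joint w * (center R (w.1 (inord t.+1) (good w.1 t))
                    - center R (w.1 (inord t.+1) (X t))) = 0.
Proof.
set S := LHS; have : S = - S; last by lra.
rewrite {1}/S (reindex_inj (inv_inj exchange_nextK))/= -sumrN.
apply: eq_bigr => w _; rewrite joint_exchange_next good_exchange_next//.
by rewrite ffunE eqxx !permM tpermL tpermR -mulrN opprB.
Qed.

(** Off the good track, the tent gains one unit while rising and loses one otherwise; the factor 2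
    covers the passage from +1 to -1. *)
Lemma regret_pointwise (w : omega) :
  center R (w.1 (inord t.+1) (good w.1 t)) - center R (w.1 (inord t.+1) (X t))
  + ((X t != good w.1 t)%:R - 2 * (~~ rising w.2 t.+1)%:R) / (8 * h)%:R
  <= (adversary w t (good w.1 t))%:num - (adversary w t (X t))%:num.
Proof.
rewrite /adversary /= /reward_value eqxx opprD addrACA lerD2l -mulrBl.
rewrite ler_wpM2r ?invr_ge0//.
have h0 : (0 < h)%N by rewrite double_gt0.
have := @tent_step h (level w.2 t.+1) h0.
rewrite leqNgt -/(rising w.2 t.+1) addn1.
case: (X t == good w.1 t) => /=.
  by rewrite addn1 subrr sub0r oppr_le0 mulr_ge0.
rewrite addn0; case: rising => /= e.
  have -> : tent h (level w.2 t.+1).+1 = (tent h (level w.2 t.+1)).+1 by lia.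
  by rewrite -natr1; lra.
have <- : (tent h (level w.2 t.+1).+1).+1 = tent h (level w.2 t.+1) by lia.
by rewrite -natr1; lra.
Qed.

End Actions.

(** The player is off the good track with probability at least 1/3, the level fails to rise with
    probability at most 1/12, and [(1/3 - 2/12) / (8 h) = 1 / (48 h)]. *)
Lemma regret_round :
  (\sum_w mass w) / (48 * h)%:R <=
  \sum_w mass w * ((adversary w t (good w.1 t))%:num
    - \sum_(x : {ffun 'I_t.+1 -> 'I_3})
        play_law A (adversary w) x * (adversary w t (x ord_max))%:num).
Proof.
set Z := \sum_w mass w.
pose bad := \sum_w mass w * (~~ rising w.2 t.+1)%:R.
have sum_joint (F : omega -> R) :
    \sum_x \sum_w joint x w * F w = \sum_w mass w * F w.
  rewrite exchange_big/=; apply: eq_bigr => w _.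
  rewrite -big_distrl/= -big_distrr/= sum_play_law mulr1//.
have bad_small : 12 * bad <= Z.
  rewrite /bad /Z.
  rewrite -(pair_bigA _ (fun (s : tracks) (xi : tree_noise L T (h + h)) =>
    weight (noise_weight q) xi * (~~ rising xi t.+1)%:R))/=.
  rewrite -(pair_bigA _ (fun (s : tracks) (xi : tree_noise L T (h + h)) =>
    weight (noise_weight q) xi))/=.
  by rewrite big_distrr/=; apply: ler_sum => s _; apply: not_rising_rare.
have -> : \sum_w mass w * ((adversary w t (good w.1 t))%:num
    - \sum_(x : {ffun 'I_t.+1 -> 'I_3})
        play_law A (adversary w) x * (adversary w t (x ord_max))%:num) =
    \sum_(x : {ffun 'I_t.+1 -> 'I_3}) \sum_w joint x w *
      ((adversary w t (good w.1 t))%:num - (adversary w t (x (inord t)))%:num).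
  rewrite exchange_big/=; apply: eq_bigr => w _.
  under [RHS]eq_bigr => x _ do rewrite /joint -mulrA mulrBr -(XE x ord_max).
  by rewrite -big_distrr/= sumrB -big_distrl/= sum_play_law mul1r.
apply: (@le_trans _ _ (\sum_(x : {ffun 'I_t.+1 -> 'I_3})
   (\sum_w joint x w / 3 - 2 * \sum_w joint x w * (~~ rising w.2 t.+1)%:R)
     / (8 * h)%:R)).
  rewrite -big_distrl/= sumrB -big_distrr/= (sum_joint (fun=> 3^-1)).
  rewrite sum_joint -/bad -big_distrl/= -/Z.
  have -> : (48 * h = 6 * (8 * h))%N by lia.
  rewrite natrM invfM mulrA ler_wpM2r ?invr_ge0//; lra.
apply: ler_sum => x _.
apply: (@le_trans _ _ (\sum_w joint x w *
  (center R (w.1 (inord t.+1) (good w.1 t))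
   - center R (w.1 (inord t.+1) (x (inord t)))
   + ((x (inord t) != good w.1 t)%:R - 2 * (~~ rising w.2 t.+1)%:R)
     / (8 * h)%:R))); last first.
  by apply: ler_sum => w _; rewrite ler_wpM2l ?joint_ge0 ?regret_pointwise.
under [leRHS]eq_bigr => w _ do rewrite mulrDr.
rewrite big_split/= sum_joint_center add0r.
under [leRHS]eq_bigr => w _ do rewrite mulrA mulrBr mulrCA.
rewrite -[leRHS]big_distrl/= ler_wpM2r ?invr_ge0// sumrB -big_distrr/= lerD2r.
have := sum_joint_good x; rewrite -big_distrl/=; lra.
Qed.

End Round.

End Adversary.

(** * From the average adversary to one reward sequence *)

Section Averaging.
Variables (R : realType) (l M T : nat) (K : R) (A : player R 3).
Let h := M.*2.
Let L := l.*2.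

Lemma policy_state_good (w : _ * tree_noise L T (h + h)) t :
  policy_state (stateful_of_reactive (commute_policies R (good w.1 0)))
    (adversary R w) t = good w.1 t.
Proof. by elim: t => // t /= ->; rewrite commute_reward. Qed.

Lemma regret_adversary (w : _ * tree_noise L T (h + h)) :
  \sum_(t < T) ((adversary R w t (good w.1 t))%:num
    - \sum_(x : {ffun 'I_t.+1 -> 'I_3})
        play_law A (adversary R w) x * (adversary R w t (x ord_max))%:num)
  <= regret T (fun i => stateful_of_reactive (commute_policies R i)) A
       (adversary R w).
Proof.
rewrite sumrB -expected_rewardE lerB//.
apply: le_trans (le_bigmax _ _ (good w.1 0)).
by apply: ler_sum => t _; rewrite /policy_action policy_state_good.
Qed.

Lemma exists_regret : 1 < K -> (0 < M)%N -> (T < 2 ^ L)%N ->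
  1 / 2 <= (1 - K^-1) ^+ L -> 12 * (L%:R * (13 * K ^+ 2)) <= h%:R ^+ 2 ->
  exists r : rewards R 3, T%:R / (48 * h)%:R
    <= regret T (fun i => stateful_of_reactive (commute_policies R i)) A r.
Proof.
move=> K1 M0 TL qL small.
apply: contrapT => /forallNP no_regret.
pose m := @mass R l M T K.
have K0 : 0 < K := lt_trans ltr01 K1.
(* Here [K > 1] is strict: positive masses preserve strict inequalities when averaging. *)
have m0 w : 0 < m w.
  by apply: prodr_gt0 => nd _; rewrite exprn_gt0// subr_gt0 invf_lt1.
have : \sum_w m w * (T%:R / (48 * h)%:R) <= \sum_w m w *
  regret T (fun i => stateful_of_reactive (commute_policies R i)) A
    (adversary R w).
  apply: (@le_trans _ _ (\sum_(t < T) \sum_w m w *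
      ((adversary R w t (good w.1 t))%:num
    - \sum_(x : {ffun 'I_t.+1 -> 'I_3})
        play_law A (adversary R w) x * (adversary R w t (x ord_max))%:num))).
    apply: (@le_trans _ _ (\sum_(t < T) (\sum_w m w) / (48 * h)%:R)).
      by rewrite sumr_const card_ord -big_distrl/= -[leRHS]mulr_natl mulrCA.
    by apply: ler_sum => t _; apply: regret_round => //; apply: ltW.
  rewrite exchange_big/=; apply: ler_sum => w _.
  by rewrite -big_distrr/= ler_wpM2l ?regret_adversary// ltW.
apply/negP; rewrite -ltNge.
have h0 : (0 < h + h)%N by rewrite addn_gt0 double_gt0 M0.
(* An explicit outcome shows that the average is over a nonempty set. *)
pose w0 : _ * tree_noise L T (h + h) :=
  (([ffun=> 1%g] : {ffun 'I_T.+1 -> {perm 'I_3}}), [ffun=> Ordinal h0]).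
have lt_regret (w : _ * tree_noise L T (h + h)) :
    m w * regret T (fun i => stateful_of_reactive (commute_policies R i)) A
      (adversary R w) < m w * (T%:R / (48 * h)%:R).
  by rewrite ltr_pM2l// ltNge; apply/negP/no_regret.
rewrite (bigD1 w0)//= [ltRHS](bigD1 w0)//= ltr_leD//.
by apply: ler_sum => w _; apply: ltW.
Qed.

End Averaging.

(** * Choice of parameters and conclusion *)

Section Constants.
Variable R : realType.

Lemma bernoulli (x : R) n : 0 <= x <= 1 -> 1 - n%:R * x <= (1 - x) ^+ n.
Proof.
move=> /andP[x0 x1]; elim: n => [|n IH]; first by rewrite mul0r subr0 expr0.
rewrite exprS -natr1; have n0 : 0 <= n%:R :> R by [].
have x1' : 0 <= 1 - x by lra.
by have := ler_wpM2l x1' IH; nra.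
Qed.

(** With the depth a multiple of a square, [log^(3/2) T] is of order [u^3] and all parameters can be
    integers. *)
Lemma depth_choice T : (16 <= T)%N ->
  exists2 u, (0 < u)%N & (2 ^ u ^ 2 <= T < 2 ^ (2 * u ^ 2).*2)%N.
Proof.
move=> T16; have ex : exists u, (T < 2 ^ (2 * u ^ 2).*2)%N.
  exists T; apply: leq_trans (ltn_expl T (ltnSn 1)) _.
  by rewrite leq_exp2l//; nia.
case: (ex_minnP ex) => u Tu minu.
have u2 : (2 <= u)%N.
  by move: Tu; case: u {minu} => [|[|u]]//; rewrite ltnNge (leq_trans _ T16).
exists u; first by lia.
(* Otherwise [u - 1] would do as well, since [4 (u - 1)^2 >= u^2] for [u >= 2]. *)
rewrite Tu andbT leqNgt; apply/negP => Tlt.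
have := minu u.-1; rewrite (leq_trans Tlt); first by move=> /(_ isT); lia.
by rewrite leq_exp2l//; case: u u2 {Tu minu Tlt} => [|[|u]]//= _; nia.
Qed.

(** The crude bound [ln 2 >= 1/4] gives [ln T >= (u / 2)^2], a square whose power 3/2 is
    explicit. *)
Lemma ln_powR_ge (u T : nat) : (2 ^ u ^ 2 <= T)%N ->
  (u%:R / 2) ^+ 3 <= ln (T%:R : R) `^ (3 / 2).
Proof.
move=> uT.
have ln2 : 1 / 4 <= ln (2 : R).
  have := @le_ln1Dx R (- (1 / 2)).
  have -> : 1 + - (1 / 2) = 2^-1 :> R by field.
  rewrite lnV ?posrE//; lra.
have lnT : (u%:R / 2) ^+ 2 <= ln (T%:R : R).
  apply: (@le_trans _ _ (ln ((2 ^ u ^ 2)%:R : R))).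
    rewrite natrX lnXn// -[leRHS]mulr_natr natrX.
    have : 0 <= u%:R ^+ 2 :> R by rewrite sqr_ge0.
    nra.
  by rewrite ler_ln ?posrE ?ltr0n ?ler_nat ?(leq_trans _ uT) ?expn_gt0.
have u0 : 0 <= u%:R / 2 :> R by rewrite divr_ge0.
apply: le_trans (ge0_ler_powR _ _ _ lnT); rewrite ?nnegrE ?exprn_ge0//.
- rewrite -(powR_mulrn 2 u0) -powRrM.
  by rewrite (_ : 2%:R * (3 / 2) = 3%:R :> R) ?powR_mulrn//; field.
- by apply: le_trans lnT; rewrite exprn_ge0.
Qed.

End Constants.

Theorem theorem4 (R : realType) :
  exists (c : R) (T0 : nat), 0 < c /\ (0 < T0)%N /\
    forall T : nat, (T0 <= T)%N ->
      (forall A : ('I_3 -> reactive_policy R 3) -> player R 3,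
         exists (Pi : 'I_3 -> reactive_policy R 3) (r : rewards R 3),
           injective Pi /\
           c * T%:R / ln (T%:R : R) `^ (3 / 2)
             <= regret T (fun i => stateful_of_reactive (Pi i)) (A Pi) r) /\
      (forall A : player R 3,
         exists r : rewards R 3,
           c * T%:R / ln (T%:R : R) `^ (3 / 2)
             <= regret T (fun i => stateful_of_reactive (commute_policies R i))
                  A r).
Proof.
(* 48 comes from [exists_regret], 200 from [h = 200 u^3], and 8 from [(u / 2)^3]. *)
exists (48 * 200 * 8)^-1, 16%N; split; first by rewrite invr_gt0 !mulr_gt0.
split=> // T T16.
suff commute_regret A : exists r : rewards R 3,
    (48 * 200 * 8)^-1 * T%:R / ln (T%:R : R) `^ (3 / 2)
    <= regret T (fun i => stateful_of_reactive (commute_policies R i)) A r.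
  split=> // A; have [r le_r] := commute_regret (A (commute_policies R)).
  exists (commute_policies R), r; split=> // i j.
  exact: (congr1 (@init_action R 3)).
have [u u0 /andP[uT Tu]] := depth_choice T16.
have ur : 1 <= u%:R :> R by rewrite ler1n.
have u2 : 1 <= (u%:R : R) ^+ 2 by rewrite exprn_ege1.
have Lr : ((2 * u ^ 2).*2%:R : R) = 4 * u%:R ^+ 2.
  by rewrite -natrX -natrM; congr (_%:R); lia.
have hr : ((100 * u ^ 3).*2%:R : R) = 200 * u%:R ^+ 3.
  by rewrite -natrX -natrM; congr (_%:R); lia.
(* Here [L = 4 u^2] and [K = 8 u^2], so [L / K = 1/2] and Bernoulli's inequality applies. For the
   variance, [12 * 4 * 13 * 64 = 39936] is below [200^2]. *)
have [|||||r le_r] := @exists_regret R (2 * u ^ 2) (100 * u ^ 3) T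
    (8 * u%:R ^+ 2) A.
- lra.
- by rewrite muln_gt0 expn_gt0 u0.
- exact: Tu.
- apply: le_trans (bernoulli _ _).
    by rewrite Lr (_ : 4 * _ * _ = 1 / 2); [lra|field; lra].
  by rewrite invr_ge0 invf_le1; lra.
- by rewrite Lr hr; nra.
exists r; apply: le_trans le_r.
have := ln_powR_ge R uT; set Y := _ `^ _ => le_Y.
have c0 : 0 < (u%:R / 2) ^+ 3 :> R by rewrite exprn_gt0// divr_gt0//; lra.
have Y0 : 0 < Y := lt_le_trans c0 le_Y.
rewrite mulrAC mulrC ler_wpM2l// natrM hr -invfM lef_pV2 ?posrE.
- move: le_Y; rewrite expr_div_n; lra.
- by rewrite mulr_gt0.
- by rewrite !mulr_gt0 ?exprn_gt0//; lra.
Qed.
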